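(* Let $n$ and $k$ be positive integers with $n+2 \leq k < 2^{n-1}$, and let $d$ be the largest integer such that $k > \sum_{i=0}^{d}\binom{n}{i}$. Let $Q_n$ be the $n$-dimensional hypercube graph. Then \[ b_k(Q_n) \leq n-d+1. \]
   Context: All graphs are finite, simple and undirected. The hypercube $Q_n$ has vertex set the power set of $[n]=\{1,\dots,n\}$, with $u,v$ adjacent iff $|u\Delta v|=1$. $k$-liminal burning game on $G$ ($k$ a positive integer): two players, Saboteur and Arsonist. Each vertex is burned or unburned, and revealed or unrevealed; initially all are unburned and unrevealed. In each round: (i) propagation: every unburned vertex with a neighbor burned in an earlier round becomes burned (whether revealed or not); (ii) the Saboteur reveals $k$ vertices that are unrevealed and unburned (all such vertices if fewer than $k$ exist); revealed vertices stay revealed; (iii) the Arsonist burns one revealed unburned vertex (revealed in this or any earlier round), if one exists. The game ends in the round in which all vertices are burned. The Saboteur maximizes and the Arsonist minimizes the number of rounds; $b_k(G)$ is the number of rounds under optimal play. *)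

(* Defs.v *)
From mathcomp Require Import all_boot.
Set Implicit Arguments.
Unset Strict Implicit.
Unset Printing Implicit Defensive.

Record sgraph := SGraph {
  vertex :> finType;
  adj : rel vertex;
  adj_sym : symmetric adj;
  adj_irr : irreflexive adj }.

Section LiminalBurning.
Variables (G : sgraph) (k : nat).
Implicit Types B R S C : {set G}.

Definition propagate B : {set G} := B :|: [set v | [exists u in B, adj u v]].

(* B is the burned set after propagation, R the previously revealed set. *)
Definition legal_reveal B R S : bool :=
  (S \subset ~: (R :|: B)) && (#|S| == minn k #|~: (R :|: B)|).

(* The possible burned sets after the Arsonist's move; B is the burned set
   after propagation and R includes the vertices revealed in this round. *)
Definition burn_options B R : {set {set G}} :=
  if R \subset B then [set B] else [set v |: B | v in R :\: B].

(* Minimax number of remaining rounds when a round begins with B burned and R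
   revealed.  The recursion stops after m rounds; by rounds_stable below this
   cut-off has no effect when 0 < k and m >= #|~: B|.  The index m' of the
   minimum is neutral: burn_options is nonempty and rounds m' is at most m'. *)
Fixpoint rounds m B R : nat :=
  if m isn't m'.+1 then 0 else
  if B == setT then 0 else
  (\max_(S | legal_reveal (propagate B) R S)
     \big[minn/m']_(C in burn_options (propagate B) (R :|: S))
        rounds m' C (R :|: S)).+1.

Definition liminal_burning : nat := rounds #|G| set0 set0.

Lemma rounds_le m B R : rounds m B R <= m.
Proof.
case: m => //= m; case: ifP => // _; rewrite ltnS.
apply/bigmax_leqP => S _.
by elim/big_rec: _ => // C x _ lex; rewrite geq_min lex orbT.
Qed.

Lemma burn_options_neq0 B R : exists C, C \in burn_options B R.
Proof.
rewrite /burn_options; case: ifP => [_|/negbT/subsetPn[v vR vB]].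
  by exists B; rewrite inE.
by exists (v |: B); apply: imset_f; rewrite inE vB.
Qed.

Lemma burn_options_card B R S C : 0 < k -> B != setT ->
  legal_reveal (propagate B) R S ->
  C \in burn_options (propagate B) (R :|: S) -> #|~: C| < #|~: B|.
Proof.
move=> k0 BT /andP[sS /eqP cS] CP.
have sB : B \subset propagate B by apply: subsetUl.
suff pBC : B \proper C by apply: proper_card; rewrite properC.
move: sB sS cS CP; set B' := propagate B => sB sS cS.
rewrite /burn_options; case: ifP => [sRB|_]; last first.
  case/imsetP=> v; rewrite inE => /andP[vB _] ->.
  rewrite properE (subset_trans sB (subsetUr _ _)) /=.
  apply/subsetPn; exists v; first by rewrite !inE eqxx.
  by apply: contra vB; apply: (subsetP sB).
rewrite inE => /eqP->; rewrite properEneq sB andbT.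
move: sRB; rewrite subUset => /andP[sR sSB].
apply: contraNneq BT => eB.
have S0 : S = set0.
  apply/setP=> v; rewrite inE; apply/negP=> vS.
  by move: (subsetP sS v vS); rewrite in_setC in_setU (subsetP sSB v vS) orbT.
move: cS; rewrite S0 cards0 (setUidPr sR) => /esym/eqP.
rewrite -leqn0 geq_min leqNgt k0 /= leqn0 cards_eq0 -eB => /eqP eC.
by rewrite -[B]setCK eC setC0.
Qed.

Lemma rounds_stable m B R :
  0 < k -> #|~: B| <= m -> rounds m B R = rounds #|~: B| B R.
Proof.
move=> k0; suff st j B' R' : #|~: B'| <= j -> rounds j.+1 B' R' = rounds j B' R'.
  elim: m => [|m IH]; first by rewrite leqn0 => /eqP->.
  by rewrite leq_eqVlt => /predU1P[->//|]; rewrite ltnS => h; rewrite st ?IH.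
elim: j B' R' => [|j IH] B' R' leB.
  move: leB; rewrite leqn0 cards_eq0 => /eqP eC.
  by rewrite /= -[B']setCK eC setC0 eqxx.
have rS l A A' : rounds l.+1 A A' = if A == setT then 0 else
  (\max_(S | legal_reveal (propagate A) A' S)
     \big[minn/l]_(C in burn_options (propagate A) (A' :|: S))
        rounds l C (A' :|: S)).+1 by [].
rewrite (rS j.+1) (rS j); case: ifP => // /negbT BT; congr _.+1.
apply: eq_bigr => S lS; set P := burn_options _ _.
have [C0 C0P] : exists C, C \in P by apply: burn_options_neq0.
transitivity (\big[minn/j.+1]_(C in P) rounds j C (R' :|: S)).
  apply: eq_bigr => C CP; apply: IH; rewrite -ltnS.
  exact: leq_trans (burn_options_card k0 BT lS CP) leB.
have -> : \big[minn/j]_(C in P) rounds j C (R' :|: S)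
    = minn j (\big[minn/j.+1]_(C in P) rounds j C (R' :|: S)).
  elim/big_rec2: _ => [|C x y _ ->]; first by rewrite (minn_idPl _).
  by rewrite minnCA.
apply/esym/minn_idPr; apply: leq_trans (rounds_le j C0 (R' :|: S)).
have : C0 \in index_enum {set G} by rewrite mem_index_enum.
elim: (index_enum _) => // C s IHs; rewrite big_cons inE => /predU1P[<-|C0s].
  by rewrite C0P geq_minl.
by case: ifP => _; rewrite ?geq_min IHs ?orbT.
Qed.
End LiminalBurning.

Section Hypercube.
Variable n : nat.

Definition hypercube_adj (u v : {set 'I_n}) : bool :=
  #|(u :\: v) :|: (v :\: u)| == 1.

Lemma hypercube_adj_sym : symmetric hypercube_adj.
Proof. by move=> u v; rewrite /hypercube_adj setUC. Qed.

Lemma hypercube_adj_irr : irreflexive hypercube_adj.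
Proof. by move=> u; rewrite /hypercube_adj setDv setU0 cards0. Qed.

Definition hypercube : sgraph := SGraph hypercube_adj_sym hypercube_adj_irr.
End Hypercube.

(* Main.v *)
(** By Kleitman's theorem the k > sum_(i <= d) C(n, i) vertices revealed in the
    first round include two, u and v, at distance at least 2d+1.  The Arsonist
    burns u, then v.  Every vertex x satisfies d(x, u) + d(x, v) <= 2n - d(u, v),
    so d(x, u) <= n-d or d(x, v) <= n-d-1, and the two fires cover the cube in
    n-d+1 rounds.

    Kleitman's theorem is proved by a quadratic form.  Let chi_S be the
    characters of the cube and
      w(S) = (-1)^|S| prod_(d < m < n-d) (2m+1 - 2|S|).
    The product has degree less than n-2d in |S|, hence is orthogonal to every
    chi_E with |E| >= n-2d, and so w is orthogonal to chi_D for |D| <= 2d.  If F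
    has diameter at most 2d, then sum_S w(S) <v, chi_S>^2 = 0 for each v
    supported on F.  Up to a global sign, w is negative only on a set P of at
    most sum_(i <= d) C(n, i) sets S.  If |F| > |P|, some v <> 0 is orthogonal
    to chi_S for all S in P, so every <v, chi_S> vanishes and v = 0. *)
Require Import Defs.
From mathcomp Require Import all_boot.
From mathcomp Require Import all_order all_algebra zify ring lra.
Set Implicit Arguments.
Unset Strict Implicit.
Unset Printing Implicit Defensive.
Import Order.TTheory GRing.Theory Num.Theory.

(** * Symmetric differences and counts of small sets *)

Definition symdiff (T : finType) (A B : {set T}) : {set T} :=
  [set x | (x \in A) (+) (x \in B)].

Lemma symdiffE (T : finType) (A B : {set T}) :
  symdiff A B = (A :\: B) :|: (B :\: A).
Proof. by apply/setP => x; rewrite !inE; do 2!case: (_ \in _). Qed.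

Lemma symdiffC (T : finType) (A B : {set T}) : symdiff A B = symdiff B A.
Proof. by apply/setP => x; rewrite !inE addbC. Qed.

Lemma symdiffKr (T : finType) (B : {set T}) : involutive (fun A => symdiff A B).
Proof. by move=> A; apply/setP => x; rewrite !inE addbK. Qed.

Lemma symdiffvv (T : finType) (A : {set T}) : symdiff A A = set0.
Proof. by apply/setP => x; rewrite !inE addbb. Qed.

Lemma symdiff_eq0 (T : finType) (A B : {set T}) : (symdiff A B == set0) = (A == B).
Proof.
apply/eqP/eqP => [|->]; last exact: symdiffvv.
move=> /setP AB; apply/setP => x; move: (AB x); rewrite !inE.
by do 2!case: (_ \in _).
Qed.

Lemma card_symdiff1 (T : finType) (x : T) (A : {set T}) :
  #|A| <= #|symdiff [set x] A|.+1.
Proof.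
suff /subset_leq_card/leq_trans : A \subset x |: symdiff [set x] A.
  by apply; rewrite cardsU1; case: (_ \notin _).
by apply/subsetP => y yA; rewrite !inE yA; case: (y == x).
Qed.

(** Each point lies in none or exactly two of the three symmetric differences. *)
Lemma card_symdiff3 (T : finType) (A B C : {set T}) :
  #|symdiff A C| + #|symdiff B C| + #|symdiff A B| <= #|T|.*2.
Proof.
have cE (D : {set T}) : #|D| = \sum_x (x \in D : nat).
  by rewrite -sum1_card big_mkcond; apply: eq_bigr => x _; case: (_ \in _).
rewrite !cE -!big_split /= -muln2 -sum_nat_const.
by apply: leq_sum => x _; rewrite !inE; do 3!case: (_ \in _).
Qed.

Lemma card_sets_le (T : finType) (d : nat) :
  #|[set S : {set T} | #|S| <= d]| = \sum_(0 <= i < d.+1) 'C(#|T|, i).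
Proof.
pose p (S : {set T}) : 'I_d.+1 := inord #|S|.
rewrite big_mkord -sum1_card (partition_big p xpredT) //=.
apply: eq_bigr => i _; rewrite -card_draws -sum1_card; apply: eq_bigl => S.
rewrite !inE /p; apply/andP/eqP => [[Sd /eqP<-]|->]; first by rewrite inordK.
by rewrite inord_val -ltnS ltn_ord.
Qed.

(** Complementation injects the sets of size above [d] into those of size at most [d]. *)
Lemma half_cube_le (T : finType) (d : nat) : #|T| <= d.*2 ->
  2 ^ #|T| <= (#|[set S : {set T} | #|S| <= d]|).*2.
Proof.
move=> Td; rewrite -cardsT -card_powerset powersetT cardsT.
rewrite -(cardsC [set S : {set T} | #|S| <= d]) -addnn leq_add2l.
rewrite -(card_imset _ (@setC_inj T)); apply/subset_leq_card/subsetP => _ /imsetP[S Sd ->].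
by move: Sd; rewrite !inE; have := cardsC S; lia.
Qed.

(** * Walsh characters and their moments *)

Local Open Scope ring_scope.

(* The Walsh character (-1)^|A :&: S|. *)
Definition chi (T : finType) (A S : {set T}) : rat :=
  \prod_x (-1) ^+ ((x \in A) && (x \in S)).

Lemma chiC (T : finType) (A S : {set T}) : chi A S = chi S A.
Proof. by apply: eq_bigr => x _; rewrite andbC. Qed.

Lemma chi_symdiff (T : finType) (A B S : {set T}) :
  chi (symdiff A B) S = chi A S * chi B S.
Proof.
rewrite /chi -big_split; apply: eq_bigr => x _ /=; rewrite inE.
by do 3!case: (_ \in _) => //=; rewrite ?mulr1 ?mul1r // mulrNN mulr1.
Qed.

Lemma chi1 (T : finType) (x : T) (S : {set T}) :
  chi [set x] S = 1 - 2 * (x \in S)%:R.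
Proof.
rewrite /chi (bigD1 x) //= inE eqxx big1 ?mulr1 => [|y /negPf yx].
  by case: (x \in S); rewrite /= ?mulr1 ?mulr0 ?subr0 // opprD addrA subrr sub0r.
by rewrite inE yx.
Qed.

Lemma chiT (T : finType) (S : {set T}) : chi setT S = (-1) ^+ #|S|.
Proof.
rewrite -prodr_const [RHS]big_mkcond /=; apply: eq_bigr => x _.
by rewrite inE; case: (x \in S).
Qed.

Lemma chi0 (T : finType) (S : {set T}) : chi set0 S = 1.
Proof. by apply: big1 => x _; rewrite inE. Qed.

Lemma sum_chi1 (T : finType) (S : {set T}) :
  \sum_x chi [set x] S = #|T|%:R - 2 * #|S|%:R.
Proof.
under eq_bigr do rewrite chi1.
rewrite sumrB sumr_const -mulr_sumr -natr_sum; congr (_ - _ * _%:R).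
by rewrite -sum1_card [RHS]big_mkcond; apply: eq_bigr => x _; case: (x \in S).
Qed.

(** Toggling a fixed [e] of [E] in [S] permutes the sets and flips the sign of [chi E S]. *)
Lemma sum_chi_eq0 (T : finType) (E : {set T}) :
  E != set0 -> \sum_(S : {set T}) chi E S = 0.
Proof.
case/set0Pn => e eE; set s := LHS.
suff : s = - s by move=> h; lra.
rewrite {1}/s (reindex_inj (inv_inj (symdiffKr [set e]))) -sumrN.
apply: eq_bigr => S _; rewrite chiC chi_symdiff chi1 eE /= chiC; ring.
Qed.

(* Since |T| - 2|S| is the sum of the chi [set x] S, multiplying by c - 2|S| only
   turns chi E into a combination of chi E and of the neighbours of E. *)
Lemma moment_chi_eq0 (T : finType) (cs : seq rat) (E : {set T}) :
  (size cs < #|E|)%N ->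
  \sum_(S : {set T}) (\prod_(c <- cs) (c - 2 * #|S|%:R)) * chi E S = 0.
Proof.
elim: cs E => [|c cs IH] E /= szE.
  under eq_bigr do rewrite big_nil mul1r.
  by apply: sum_chi_eq0; rewrite -card_gt0.
pose p (S : {set T}) := \prod_(c <- cs) (c - 2 * #|S|%:R).
transitivity (\sum_(S : {set T}) ((c - #|T|%:R) * (p S * chi E S) +
    \sum_x p S * chi (symdiff [set x] E) S)).
  apply: eq_bigr => S _; rewrite big_cons -/(p S).
  under eq_bigr do rewrite chi_symdiff mulrCA mulrC.
  by rewrite -mulr_sumr sum_chi1; ring.
rewrite big_split /= -mulr_sumr IH ?mulr0 ?add0r; last exact: ltnW.
rewrite exchange_big big1 // => x _; apply: IH.
by have := card_symdiff1 x E; lia.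
Qed.

(** The factor 2m+1-2j is negative iff m < j, and [minn r (j - a)] counts such m in [iota a r]. *)
Lemma prod_odd_shift_sign (a r j : nat) :
  0 < (-1) ^+ minn r (j - a) *
      \prod_(c <- [seq m.*2.+1%:R | m <- iota a r]) (c - 2 * j%:R : rat).
Proof.
elim: r a => [|r IH] a; first by rewrite min0n big_nil mulr1.
rewrite /= big_cons; have {IH} := IH a.+1; set p := \prod_(_ <- _) _ => IH.
have [ja|aj] := leqP j a.
  have -> : minn r.+1 (j - a) = minn r (j - a.+1) by lia.
  rewrite mulrCA mulr_gt0 // subr_gt0 -natrM ltr_nat; lia.
have -> : minn r.+1 (j - a) = (minn r (j - a.+1)).+1 by lia.
have -> : (-1) ^+ (minn r (j - a.+1)).+1 * ((a.*2.+1%:R - 2 * j%:R) * p)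
  = (2 * j%:R - a.*2.+1%:R) * ((-1) ^+ minn r (j - a.+1) * p) by rewrite exprS; ring.
by rewrite mulr_gt0 // subr_gt0 -natrM ltr_nat; lia.
Qed.

(** * Kleitman's diameter bound *)

Lemma kleitman_card (n d : nat) (F : {set {set 'I_n}}) :
  (d.*2 < n)%N ->
  (forall A B, A \in F -> B \in F -> #|symdiff A B| <= d.*2)%N ->
  (#|F| <= \sum_(0 <= i < d.+1) 'C(n, i))%N.
Proof.
(* [r] counts the m with d < m < n-d. *)
move=> dn diamF; set r := (n - d.*2.+1)%N.
pose cs : seq rat := [seq m.*2.+1%:R | m <- iota d.+1 r].
pose w (S : {set 'I_n}) : rat :=
  (\prod_(c <- cs) (c - 2 * #|S|%:R)) * chi setT S.
(* S is in P iff #|S| <= d and #|S| = d mod 2, or #|S| > n - d and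
   #|S| = n - d + 1 mod 2. *)
pose P := [set S : {set 'I_n} | odd (#|S| + minn r (#|S| - d.+1) + d.+1)].
have wP S : S \notin P -> 0 < (-1) ^+ d.+1 * w S.
  rewrite inE => Sodd; rewrite /w chiT.
  have := prod_odd_shift_sign d.+1 r #|S|; rewrite -/cs; set p := \prod_(_ <- _) _.
  suff -> : (-1) ^+ minn r (#|S| - d.+1) = (-1) ^+ d.+1 * (-1) ^+ #|S| :> rat.
    by rewrite mulrAC mulrA.
  by rewrite -exprD -signr_odd -[RHS]signr_odd; congr (_ ^+ nat_of_bool _); lia.
have wchi (D : {set 'I_n}) : (#|D| <= d.*2)%N -> \sum_S w S * chi D S = 0.
  move=> Dd; transitivity (\sum_(S : {set 'I_n})
      (\prod_(c <- cs) (c - 2 * #|S|%:R)) * chi (symdiff setT D) S).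
    by apply: eq_bigr => S _; rewrite chi_symdiff mulrA.
  apply: moment_chi_eq0; rewrite size_map size_iota symdiffE setDT setU0 setTD.
  by have := cardsC D; rewrite card_ord; lia.
have cardP : (#|P| <= \sum_(0 <= i < d.+1) 'C(n, i))%N.
  have <- : #|[set S : {set 'I_n} | (#|S| <= d)%N]| = (\sum_(0 <= i < d.+1) 'C(n, i))%N.
    by rewrite card_sets_le card_ord.
  (* Members of [P] of size at most [d] have the parity of [d]; complements of the others have the
     opposite parity, so the images do not collide. *)
  pose g (S : {set 'I_n}) := if (#|S| <= d)%N then S else ~: S.
  have cC (S : {set 'I_n}) : (#|S| + #|~: S| = n)%N by rewrite cardsC card_ord.
  have g_inj : {in P &, injective g}.
    move=> S S'; rewrite !inE /g => hS hS'.
    case: leqP => Sd; case: leqP => Sd' //; last exact: setC_inj.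
      by move=> e; have := cC S'; rewrite -e; lia.
    by move=> e; have := cC S; rewrite e; lia.
  rewrite -(card_in_imset g_inj); apply/subset_leq_card/subsetP => _ /imsetP[S SP ->].
  by move: SP; rewrite !inE /g; have := cC S; have [//|Sd] := leqP #|S| d; lia.
apply: leq_trans cardP; rewrite leqNgt; apply/negP => PF.
pose M : 'M[rat]_(#|F|, #|P|) := \matrix_(i, j) chi (enum_val i) (enum_val j).
have kerM : kermx M != 0.
  by rewrite kermx_eq0 /row_free ltn_eqF // (leq_ltn_trans (rank_leq_col M)).
have [v vM v0] : exists2 v : 'rV_#|F|, v *m M = 0 & v != 0.
  case/rowV0Pn: kerM => v /sub_kermxP vM v0; by exists v.
pose a S := \sum_i v 0 i * chi (enum_val i) S.
have a0P S : S \in P -> a S = 0.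
  move=> SP; have /rowP/(_ (enum_rank_in SP S)) := vM; rewrite !mxE => <-.
  by apply: eq_bigr => i _; rewrite mxE enum_rankK_in.
have wa0 : \sum_S w S * (a S * a S) = 0.
  (* Expanding the square leaves only characters of differences of members of [F], to which [wchi]
     applies. *)
  transitivity (\sum_i \sum_j v 0 i * v 0 j *
      \sum_S w S * chi (symdiff (enum_val i) (enum_val j)) S).
    under [RHS]eq_bigr => i _.
      under eq_bigr do rewrite mulr_sumr.
      rewrite exchange_big; over.
    rewrite [RHS]exchange_big; apply: eq_bigr => S _.
    rewrite {1}/a mulr_suml mulr_sumr; apply: eq_bigr => i _.
    rewrite /a !mulr_sumr; apply: eq_bigr => j _.
    by rewrite chi_symdiff; ring.
  apply: big1 => i _; apply: big1 => j _.
  by rewrite wchi ?mulr0 // diamF ?enum_valP.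
have a0 S : a S = 0.
  have wa_ge0 S' : 0 <= (-1) ^+ d.+1 * (w S' * (a S' * a S')).
    have [/a0P->|/wP/ltW h] := boolP (S' \in P); first by rewrite !mulr0.
    by rewrite [X in _ <= X]mulrA mulr_ge0 // -expr2 sqr_ge0.
  have [/a0P//|/wP h] := boolP (S \in P).
  have := congr1 ( *%R ((-1) ^+ d.+1)) wa0; rewrite mulr0 mulr_sumr => /psumr_eq0P.
  move=> /(_ (fun S' _ => wa_ge0 S') S isT)/eqP.
  by rewrite [X in X == _]mulrA mulf_eq0 (gt_eqF h) mulf_eq0 orbb => /eqP.
case/eqP: v0; apply/rowP => j; rewrite mxE.
(* Fourier inversion: by orthogonality this sum is [v 0 j] times the number of sets. *)
have : \sum_S a S * chi (enum_val j) S = 0 by apply: big1 => S _; rewrite a0 mul0r.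
have -> : \sum_S a S * chi (enum_val j) S =
    \sum_i v 0 i * \sum_S chi (symdiff (enum_val i) (enum_val j)) S.
  under [RHS]eq_bigr do rewrite mulr_sumr.
  rewrite [RHS]exchange_big; apply: eq_bigr => S _.
  by rewrite mulr_suml; apply: eq_bigr => i _; rewrite chi_symdiff mulrA.
rewrite (bigD1 j) //= [X in _ + X]big1 => [|i ij]; last first.
  by rewrite sum_chi_eq0 ?mulr0 // symdiff_eq0 (inj_eq enum_val_inj).
rewrite addr0 symdiffvv; under eq_bigr do rewrite chi0.
move/eqP; rewrite mulf_eq0 sumr_const pnatr_eq0 => /orP[/eqP//|].
by move=> /eqP/card0_eq/(_ set0).
Qed.

Local Close Scope ring_scope.

(** * Propagation and upper bounds on the game length *)

Lemma propagateS (G : sgraph) (B C : {set G}) :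
  B \subset C -> propagate B \subset propagate C.
Proof.
move=> BC; rewrite setUSS //; apply/subsetP => v; rewrite !inE.
by case/exists_inP => u uB uv; apply/exists_inP; exists u; rewrite ?(subsetP BC).
Qed.

Lemma iter_propagateS (G : sgraph) (t : nat) (B C : {set G}) :
  B \subset C -> iter t (@propagate _) B \subset iter t (@propagate _) C.
Proof. by move=> BC; elim: t => //= t; apply: propagateS. Qed.

(** A minimum is bounded by any of its terms, so one good Arsonist reply to each reveal suffices. *)
Lemma rounds_step (G : sgraph) (k t m : nat) (B R : {set G}) :
  (forall m' S, legal_reveal k (propagate B) R S ->
     exists2 C, C \in burn_options (propagate B) (R :|: S) &
       rounds k m' C (R :|: S) <= t) ->
  rounds k m B R <= t.+1.
Proof.
case: m => //= m h; case: ifP => // _; rewrite ltnS.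
apply/bigmax_leqP => S /(h m)[C CP Ct]; apply: leq_trans Ct.
have : C \in index_enum {set G} by rewrite mem_index_enum.
elim: (index_enum _) => // C' s IHs; rewrite big_cons inE => /predU1P[<-|Cs].
  by rewrite CP geq_minl.
by case: ifP => _; rewrite ?geq_min IHs ?orbT.
Qed.

(** Any Arsonist move only enlarges the propagated set, and propagation is monotone. *)
Lemma rounds_iter_propagate (G : sgraph) (k t m : nat) (B R : {set G}) :
  iter t (@propagate _) B = setT -> rounds k m B R <= t.
Proof.
elim: t m B R => [|t IH] m B R.
  by move=> /= ->; case: m => //= m; rewrite eqxx.
rewrite iterSr => Bt; apply: rounds_step => m' S _.
have [C CP] := burn_options_neq0 (propagate B) (R :|: S); exists C => //.
apply: IH; apply/eqP; rewrite -subTset -Bt iter_propagateS //.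
move: CP; rewrite /burn_options; case: ifP => _; first by rewrite inE => /eqP->.
by case/imsetP => v _ ->; apply: subsetUr.
Qed.

(** Each propagation flips one coordinate where [v] and [x] differ. *)
Lemma hypercube_iter_propagate (n t : nat) (B : {set hypercube n})
    (x v : hypercube n) :
  v \in B -> #|symdiff (v : {set 'I_n}) x| <= t -> x \in iter t (@propagate _) B.
Proof.
elim: t B v => [|t IH] B v vB.
  by rewrite leqn0 cards_eq0 symdiff_eq0 => /eqP<-.
have [/eqP|/set0Pn[i ivx]] := eqVneq (symdiff (v : {set 'I_n}) x) set0.
  rewrite symdiff_eq0 => /eqP<- _; move: vB; apply/subsetP: v.
  by elim: t.+1 => //= s /subset_trans->//; apply: subsetUl.
move=> vx; rewrite iterSr; apply: (IH _ (symdiff (v : {set 'I_n}) [set i])).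
  rewrite inE; apply/orP; right; rewrite inE; apply/exists_inP; exists v => //.
  rewrite /= /hypercube_adj -symdiffE symdiffC.
  by rewrite (symdiffC v) symdiffKr cards1.
rewrite -ltnS; apply: leq_trans vx; rewrite [X in _ < X](cardsD1 i) ivx ltnS.
apply/subset_leq_card/subsetP => j; move: ivx; rewrite !inE.
by case: (eqVneq j i) => [->|_]; [do 2!case: (_ \in _) | rewrite addbF].
Qed.

(** * The two-fire strategy *)

Theorem theorem10 (n k d : nat) (n_gt0 : 0 < n) (k_gt0 : 0 < k)
  (k_range : n + 2 <= k < 2 ^ (n - 1))
  (d_sum : \sum_(0 <= i < d.+1) 'C(n, i) < k)
  (d_max : forall d' : nat, \sum_(0 <= i < d'.+1) 'C(n, i) < k -> d' <= d) :
  liminal_burning (hypercube n) k <= n - d + 1.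
Proof.
case/andP: k_range => k_lo k_hi.
have cardQ : #|hypercube n| = 2 ^ n.
  by rewrite -[LHS]cardsT -[[set: _]]powersetT card_powerset cardsT card_ord.
have pow2n : 2 ^ n = (2 ^ (n - 1)).*2 by rewrite -muln2 -expnSr subn1 prednK.
(* Otherwise the sets of size at most [d] form at least half the cube, against k < 2^(n-1). *)
have d2n : d.*2 < n.
  rewrite ltnNge; apply/negP => nd.
  have := @half_cube_le 'I_n d; rewrite card_sets_le card_ord => /(_ nd); lia.
(* The case 1 + n < k of maximality; it keeps [v] from being adjacent to [u], hence unburned in
   round two. *)
have d_gt0 : 0 < d by apply: d_max; rewrite big_nat_recr // big_nat1 bin0 bin1 /=; lia.
have prop0 : propagate (set0 : {set hypercube n}) = set0.
  apply/setP => v; rewrite !inE; apply/exists_inP => -[u]; by rewrite inE.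
rewrite addn1; apply: rounds_step => m S.
rewrite /legal_reveal prop0 setU0 set0U => /andP[_ /eqP].
rewrite setC0 cardsT cardQ (minn_idPl _); last by lia.
move=> cardS.
have [u [v [uS vS uv]]] : exists u v : {set 'I_n},
    [/\ u \in S, v \in S & d.*2 < #|symdiff u v|].
  have [/existsP[u /existsP[v /and3P[]]]|far] :=
      boolP [exists u : {set 'I_n}, [exists v : {set 'I_n},
        [&& u \in S, v \in S & d.*2 < #|symdiff u v|]]].
    by exists u, v.
  suff : #|S| <= \sum_(0 <= i < d.+1) 'C(n, i) by lia.
  apply: kleitman_card => // A B AS BS; rewrite leqNgt; apply: contra far => AB.
  by apply/existsP; exists A; apply/existsP; exists B; rewrite AS BS.
exists [set (u : hypercube n)].
  rewrite /burn_options; case: ifP => [/subsetP/(_ u uS)|_]; first by rewrite inE.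
  by apply/imsetP; exists u; rewrite ?setU0 // !inE.
have -> : n - d = (n - d).-1.+1 by lia.
apply: rounds_step => m' S' _; set B := propagate _.
have vB : (v : hypercube n) \notin B.
  rewrite !inE negb_or; apply/andP; split.
    by apply: contraTN uv => /eqP->; rewrite symdiffvv cards0.
  apply/exists_inP => -[_ /set1P->]; rewrite /= /hypercube_adj -symdiffE.
  by move/eqP=> e; move: uv; rewrite e; lia.
have vR : v \in (S :|: S') :\: B by rewrite inE vB inE vS.
exists ((v : hypercube n) |: B).
  rewrite /burn_options; case: ifP => [/subsetP/(_ v)|_]; last exact: imset_f.
  by rewrite inE vS (negPf vB) => /(_ isT).
apply: rounds_iter_propagate; apply/setP => x; rewrite [RHS]inE.
have := @card_symdiff3 'I_n u v x; rewrite card_ord => tri.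
(* [B] is already one propagation of the fire at [u], which therefore spreads n-d times, and the
   fire at [v] once less. *)
have [ux|ux] := leqP #|symdiff (u : {set 'I_n}) x| (n - d).
  apply: (subsetP (iter_propagateS (n - d).-1 (subsetUr [set (v : hypercube n)] B))).
  rewrite -iterSr prednK; last by lia.
  by apply: hypercube_iter_propagate ux; rewrite inE.
by apply: (@hypercube_iter_propagate _ _ _ _ v); [rewrite !inE eqxx | lia].
Qed.
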